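(* Let $X,Y$ be Banach spaces, $T:X\to Y$ a bounded linear operator and $1\le p<2$. If $T$ is of weak Haar type $p$, then $T$ is of Haar type $r$ for every $r$ with $1\le r<p$.
   Context: Dyadic intervals: $\Delta_k^{(j)}:=[\frac{j-1}{2^k},\frac{j}{2^k})$. Haar functions: for $k\ge1$, integer $j$, $\chi_k^{(j)}(t)=+2^{(k-1)/2}$ on $\Delta_k^{(2j-1)}$, $-2^{(k-1)/2}$ on $\Delta_k^{(2j)}$, $0$ otherwise, $t\in[0,1)$. $\mathbb D_1^n:=\{(k,j):k=1,\dots,n;\ j=1,\dots,2^{k-1}\}$. $\|f|L_q\|$ is the Bochner $L_q([0,1))$-norm of a vector-valued function. $\tau(T|\mathcal H(\mathbb D_1^n))$ is the least $c\ge0$ with $\|\sum_{(k,j)\in\mathbb D_1^n}Tx_k^{(j)}\chi_k^{(j)}|L_2\|\le c(\sum_{(k,j)\in\mathbb D_1^n}\|x_k^{(j)}\|^2)^{1/2}$ for all $x_k^{(j)}\in X$. For $1\le q\le2$, $\tau_q(T|\mathcal H(\mathbb D_1^n))$ is the least $c\ge0$ with $\|\sum_{(k,j)\in\mathbb D_1^n}Tx_k^{(j)}\chi_k^{(j)}|L_q\|\le c(\sum_{k=1}^n\|\sum_{j=1}^{2^{k-1}}x_k^{(j)}\chi_k^{(j)}|L_q\|^q)^{1/q}$ for all $x_k^{(j)}\in X$. $T$ is of Haar type $q$ ($1\le q\le 2$) if $\sup_n\tau_q(T|\mathcal H(\mathbb D_1^n))<\infty$. For $1\le p<2$, $T$ is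 of weak Haar type $p$ if there is $c\ge0$ with $\tau(T|\mathcal H(\mathbb D_1^n))\le c\,n^{1/p-1/2}$ for all $n\in\mathbb N$. *)

(* Defs.v *)
From HB Require Import structures.
From mathcomp Require Import all_boot all_order all_algebra.
From mathcomp Require Import all_classical all_reals all_analysis.
Set Implicit Arguments. Unset Strict Implicit. Unset Printing Implicit Defensive.
Import Order.TTheory GRing.Theory Num.Theory.
Import numFieldNormedType.Exports.
Local Open Scope classical_set_scope.
Local Open Scope ring_scope.

Section Haar.
Variable R : realType.

Definition in_dyadic (k j : nat) (t : R) : bool :=
  ((j.-1)%:R / 2 ^+ k <= t) && (t < j%:R / 2 ^+ k).

Definition haar (k j : nat) (t : R) : R :=
  if (0 <= t) && (t < 1) then
    if in_dyadic k (2 * j).-1 t then Num.sqrt (2 ^+ k.-1)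
    else if in_dyadic k (2 * j) t then - Num.sqrt (2 ^+ k.-1)
    else 0
  else 0.

Definition Lq_norm (V : normedModType R) (q : R) (f : R -> V) : R :=
  (fine (\int[lebesgue_measure]_(t in `[0%R, 1%R[) ((`|f t| `^ q)%:E))) `^ (q^-1).

Definition haar_sum (V : normedModType R) (n : nat) (x : nat -> nat -> V)
  (t : R) : V :=
  \sum_(1 <= k < n.+1) \sum_(1 <= j < (2 ^ k.-1).+1) haar k j t *: x k j.

Definition haar_level (V : normedModType R) (k : nat) (x : nat -> nat -> V)
  (t : R) : V :=
  \sum_(1 <= j < (2 ^ k.-1).+1) haar k j t *: x k j.

Variables X Y : normedModType R.

(* c is an admissible constant in the definition of tau(T|H(D_1^n));
   tau(T|H(D_1^n)) is the least such c. *)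
Definition tau_admissible (T : X -> Y) (n : nat) (c : R) : Prop :=
  0 <= c /\
  forall x : nat -> nat -> X,
    Lq_norm 2 (haar_sum n (fun k j => T (x k j)))
    <= c * Num.sqrt (\sum_(1 <= k < n.+1) \sum_(1 <= j < (2 ^ k.-1).+1)
                       `|x k j| ^+ 2).

Definition tauq_admissible (T : X -> Y) (q : R) (n : nat) (c : R) : Prop :=
  0 <= c /\
  forall x : nat -> nat -> X,
    Lq_norm q (haar_sum n (fun k j => T (x k j)))
    <= c * (\sum_(1 <= k < n.+1) Lq_norm q (haar_level k x) `^ q) `^ (q^-1).

Definition haar_type (T : X -> Y) (q : R) : Prop :=
  exists C : R, forall n : nat, tauq_admissible T q n C.

Definition weak_haar_type (T : X -> Y) (p : R) : Prop :=
  exists c : R, 0 <= c /\ forall n : nat, (0 < n)%N ->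
    tau_admissible T n (c * (n%:R `^ (p^-1 - 2^-1))).

End Haar.

(* Main.v *)
Require Import Defs.
From HB Require Import structures.
From mathcomp Require Import all_boot all_order all_algebra.
From mathcomp Require Import all_classical all_reals all_analysis.
From mathcomp Require Import measurable_realfun.
From mathcomp Require Import ring lra zify.
Import Order.TTheory GRing.Theory Num.Theory.
Import numFieldNormedType.Exports.
Local Open Scope ring_scope.

(* A Haar sum is a walk indexed by binary words: node coefficients are added
   with random signs, and Lq norms become averages over words of length n.
   - Weak Haar type p bounds the second moment of T applied to an n-step walk by
     n^(2/p-1) times the mean square cost. The bound remains true for longer
     walks when n is only the number of nonzero steps on each path.
   - Let q < p. If the steps of each path satisfy sum |x|^q <= 1, split them
     according to 2^-(i+1) < |x|^q <= 2^-i: at most 2^(i+1) steps of a path lie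
     in level i, and the resulting bounds decay geometrically in i because
     q < p, so E|T walk|^2 <= C E sum |x|^q.
   - Stopping a walk when sum |x|^q exceeds 1 gives, for all walks,
     E min(1,|T walk|^2) <= (C+1) E sum min(1,|x|^q).
   - Apply this to walk/lambda, multiply by lambda^r and sum over a geometric
     sequence of lambda: this is Marcinkiewicz interpolation, and for
     1 <= r < q it yields E|T walk|^r <= C' E sum |x|^r. With q = (r+p)/2 every
     r < p is reached. *)

(** * Walks indexed by binary words *)

Definition child {A : Type} (x : seq bool -> A) (b : bool) : seq bool -> A :=
  fun u => x (b :: u).

Fixpoint avg {R : realType} (n : nat) (g : seq bool -> R) : R :=
  if n is n'.+1 then (avg n' (child g false) + avg n' (child g true)) / 2
  else g [::].

(** Each step's coefficient is the node named by the letters read before it. Letter [false] carries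
    the sign +, as Haar functions do on the left half of their support. *)
Fixpoint walk {R : realType} {V : normedModType R} (x : seq bool -> V)
    (w : seq bool) : V :=
  if w is b :: w' then (-1) ^+ b *: x [::] + walk (child x b) w' else 0.

Fixpoint cost {A : Type} {R : realType} (phi : A -> R) (x : seq bool -> A)
    (w : seq bool) : R :=
  if w is b :: w' then phi (x [::]) + cost phi (child x b) w' else 0.

Section Averages.
Context {R : realType}.
Implicit Types (g h : seq bool -> R) (n : nat).

Lemma ler_avg n g h :
  (forall w, size w = n -> g w <= h w) -> avg n g <= avg n h.
Proof.
elim: n g h => [|n IHn] g h gh /=; first exact: gh.
by rewrite ler_pM2r ?invr_gt0// lerD// IHn// => w sw; apply: gh; rewrite /= sw.
Qed.

Lemma eq_avg n g h :
  (forall w, size w = n -> g w = h w) -> avg n g = avg n h.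
Proof.
by move=> gh; apply/eqP; rewrite eq_le !ler_avg// => w sw; rewrite gh.
Qed.

Lemma avgD n g h : avg n (fun w => g w + h w) = avg n g + avg n h.
Proof.
elim: n g h => [|n IHn] g h //=.
by rewrite /child (IHn (child g false)) (IHn (child g true)) -!mulrDl addrACA.
Qed.

Lemma avgZ n (a : R) g : avg n (fun w => a * g w) = a * avg n g.
Proof.
elim: n g => [|n IHn] g //=.
by rewrite /child (IHn (child g false)) (IHn (child g true)) -mulrDr mulrA.
Qed.

Lemma avg_cst n (a : R) : avg n (fun=> a) = a.
Proof. by elim: n => [//|n /= IHn]; rewrite /child IHn; field. Qed.

Lemma avg_sum n (N : nat) (g : nat -> seq bool -> R) :
  avg n (fun w => \sum_(i < N) g i w) = \sum_(i < N) avg n (g i).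
Proof.
elim: N => [|N IHN].
  by under eq_avg do rewrite big_ord0; rewrite big_ord0 avg_cst.
by under eq_avg do rewrite big_ord_recr; rewrite avgD IHN big_ord_recr.
Qed.

Lemma avg_ge0 n g : (forall w, size w = n -> 0 <= g w) -> 0 <= avg n g.
Proof. by move=> g0; rewrite -(avg_cst n 0); exact: ler_avg. Qed.

(** Only finitely many words have length at most [n], so one power of 2 serves all of them. This
    keeps the later sums over levels and over scales finite. *)
Lemma positive_values_bounds n g : exists N : nat, forall w, (size w <= n)%N ->
  0 < g w -> 2^-1 ^+ N < g w < 2 ^+ N.
Proof.
have pow_lt (a : R) : exists N : nat, forall m, (N <= m)%N -> a < 2 ^+ m.
  exists (Num.truncn `|a|).+1 => m Nm.
  rewrite (le_lt_trans (ler_norm _))// (lt_trans (truncnS_gt _))//.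
  rewrite -natrX ltr_nat; exact: leq_ltn_trans Nm (ltn_expl _ _).
elim: n g => [|n IHn] g.
  have [N1 P1] := pow_lt (g [::]); have [N2 P2] := pow_lt (g [::])^-1.
  exists (maxn N1 N2) => -[|//] _ g0; rewrite P1 ?leq_maxl// andbT.
  by rewrite exprVn invf_plt ?posrE ?exprn_gt0// P2 ?leq_maxr.
have [N0 P0] := IHn (child g false); have [N1 P1] := IHn (child g true).
have [N2 P2] := IHn g.
exists (maxn N2 (maxn N0 N1)) => w sw g0.
suff [N' N'le /andP[lo hi]] : exists2 N' : nat,
    (N' <= maxn N2 (maxn N0 N1))%N & 2^-1 ^+ N' < g w < 2 ^+ N'.
  rewrite (lt_le_trans hi) ?ler_weXn2l ?ler1n// andbT.
  by rewrite (le_lt_trans _ lo)// !exprVn lef_pV2 ?posrE ?exprn_gt0// ler_weXn2l ?ler1n.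
case: w sw g0 => [|[] w] sw g0.
- by exists N2; rewrite ?leq_maxl// P2.
- by exists N1; rewrite ?P1// !leq_max leqnn !orbT.
- by exists N0; rewrite ?P0// !leq_max leqnn !orbT.
Qed.

End Averages.

Section Walks.
Context {R : realType} {V : normedModType R}.
Implicit Types (x y : seq bool -> V) (phi psi : V -> R).

Lemma walkZ (a : R) x w : walk (fun u => a *: x u) w = a *: walk x w.
Proof.
elim: w x => [|b w IHw] x /=; first by rewrite scaler0.
by rewrite scalerDr -(IHw (child x b)) !scalerA mulrC.
Qed.

Lemma walk_sum N (x : nat -> seq bool -> V) w :
  walk (fun u => \sum_(i < N) x i u) w = \sum_(i < N) walk (x i) w.
Proof.
elim: w x => [|b w IHw] x /=; first by rewrite big1.
by rewrite big_split/= -scaler_sumr -(IHw (fun i => child (x i) b)).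
Qed.

Lemma eq_walk n x y w : (forall u, (size u < n)%N -> x u = y u) ->
  size w = n -> walk x w = walk y w.
Proof.
elim: n x y w => [|n IHn] x y [|b w]//= xy [sw]; rewrite xy//.
by rewrite (IHn _ (child y b))// => u un; exact: xy.
Qed.

Lemma walk_nth x w :
  walk x w = \sum_(0 <= k < size w) (-1) ^+ nth false w k *: x (take k w).
Proof.
elim: w x => [|b w IHw] x /=; first by rewrite big_geq.
by rewrite big_nat_recl//= IHw.
Qed.

Lemma cost_nth phi x w :
  cost phi x w = \sum_(0 <= k < size w) phi (x (take k w)).
Proof.
elim: w x => [|b w IHw] x /=; first by rewrite big_geq.
by rewrite big_nat_recl//= IHw.
Qed.

Lemma ler_cost phi psi x y w : (forall u, phi (x u) <= psi (y u)) ->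
  cost phi x w <= cost psi y w.
Proof.
move=> xy; elim: w x y xy => [|b w IHw] x y xy //=.
by rewrite lerD// IHw// => u; exact: xy.
Qed.

Lemma costZ (a : R) phi x w : cost (fun v => a * phi v) x w = a * cost phi x w.
Proof.
by elim: w x => [|b w IHw] x /=; rewrite ?mulr0// mulrDr IHw.
Qed.

Lemma cost_ge0 phi x w : (forall v, 0 <= phi v) -> 0 <= cost phi x w.
Proof.
by move=> p0; elim: w x => [|b w IHw] x /=; rewrite ?addr_ge0.
Qed.

Lemma cost_sum N (phi : nat -> V -> R) x w :
  cost (fun v => \sum_(i < N) phi i v) x w = \sum_(i < N) cost (phi i) x w.
Proof.
elim: w x => [|b w IHw] x /=; first by rewrite big1.
by rewrite big_split/= IHw.
Qed.

End Walks.

Lemma walk_linear {R : realType} {X Y : normedModType R} (T : {linear X -> Y})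
  (x : seq bool -> X) w : T (walk x w) = walk (T \o x) w.
Proof.
elim: w x => [|b w IHw] x /=; first by rewrite linear0.
by rewrite linearD linearZ/= IHw.
Qed.

(** * Sparse walks *)

Section Sparse.
Context {R : realType} {X Y : normedModType R} (T : {linear X -> Y}).
Context (Phi : Y -> R) (psi : X -> R).

(** A bound of the averaged payoff by the averaged cost says that the gain at base point 0 is at
    most 0. In this form two subtrees with a common base point can be compared. *)
Definition gain n (x : seq bool -> X) (y : Y) : R :=
  avg n (fun w => Phi (y + T (walk x w)) - cost psi x w).

Lemma gainS n x y : gain n.+1 x y =
  (gain n (child x false) (y + T (x [::])) +
   gain n (child x true) (y - T (x [::]))) / 2 - psi (x [::]).
Proof.
have step b w : Phi (y + T (walk x (b :: w))) - cost psi x (b :: w) =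
    (Phi ((y + (-1) ^+ b *: T (x [::])) + T (walk (child x b) w))
      - cost psi (child x b) w) + - psi (x [::]).
  by rewrite /= linearD linearZ addrA opprD -addrA [- _ - _]addrC !addrA.
rewrite /gain [avg n.+1 _]/= /child.
under eq_avg do rewrite step.
under [X in (_ + X) / _]eq_avg do rewrite step.
rewrite !avgD avg_cst expr0 expr1 scale1r scaleN1r; field; done.
Qed.

Lemma gain0 n y : psi 0 = 0 -> gain n (fun=> 0) y = Phi y.
Proof.
move=> psi0; elim: n => [|n IHn]; first by rewrite /gain /= linear0 addr0 subr0.
by rewrite gainS linear0 subr0 addr0 /child IHn psi0; field; done.
Qed.

(* At a vanishing node the better of the two subtrees is kept, so such nodes
   do not use up the budget m; the base point y makes the induction pass. *)
Lemma compress_sparse n m (x : seq bool -> X) y : psi 0 = 0 ->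
  (forall w, size w = n -> cost (fun v => (v != 0)%:R) x w <= m%:R :> R) ->
  exists x' : seq bool -> X, gain n x y <= gain m x' y.
Proof.
move=> psi0; elim: n m x y => [|n IHn] m x y sparse.
  exists (fun=> 0); rewrite gain0// /gain /=.
  by rewrite linear0 addr0 subr0.
have child_sparse b k : ((x [::] != 0)%:R : R) + k%:R = m%:R ->
    forall w, size w = n -> cost (fun v => (v != 0)%:R) (child x b) w <= k%:R :> R.
  by move=> xk w sw; have := sparse (b :: w); rewrite /= sw -xk lerD2l; apply.
have [x0|x0] := eqVneq (x [::]) 0.
  have sp b : forall w, size w = n ->
      cost (fun v => (v != 0)%:R) (child x b) w <= m%:R :> R.
    by apply: child_sparse; rewrite x0 eqxx add0r.
  have [xf xfP] := IHn m (child x false) y (sp false).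
  have [xt xtP] := IHn m (child x true) y (sp true).
  rewrite gainS x0 psi0 linear0 subr0 addr0 subr0.
  by have [ft|/ltW tf] := leP (gain m xf y) (gain m xt y);
    [exists xt|exists xf]; lra.
(* A zero budget contradicts the nonzero root on the path of [false] letters. Otherwise the root is
   kept and takes one unit. *)
case: m => [|m] in sparse child_sparse *.
  have := sparse (nseq n.+1 false) (size_nseq _ _).
  rewrite leNgt => /negP[]; rewrite /= x0 ltr_pwDl//.
  by rewrite cost_ge0// => v; rewrite ler0n.
have sp b : forall w, size w = n ->
    cost (fun v => (v != 0)%:R) (child x b) w <= m%:R :> R.
  by apply: child_sparse; rewrite x0 -natr1 addrC.
have [xf xfP] := IHn m (child x false) (y + T (x [::])) (sp false).
have [xt xtP] := IHn m (child x true) (y - T (x [::])) (sp true).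
exists (fun u => if u is b :: u' then if b then xt u' else xf u' else x [::]).
by rewrite !gainS /child; move: xfP xtP; rewrite /child; lra.
Qed.

End Sparse.

Definition walk_bound {R : realType} {X Y : normedModType R}
    (T : X -> Y) (s c : R) : Prop :=
  forall n x, (0 < n)%N ->
    avg n (fun w => `|T (walk x w)| ^+ 2) <=
    c * n%:R `^ s * avg n (cost (fun v => `|v| ^+ 2) x).

(** With cost [K] |v|^2, compression to length [m] does not lower the gain, and the hypothesis at
    length [m] makes the compressed gain nonpositive. *)
Lemma walk_bound_sparse {R : realType} {X Y : normedModType R}
    (T : {linear X -> Y}) (s c : R) n m x :
  walk_bound T s c -> (0 < m)%N ->
  (forall w, size w = n -> cost (fun v => (v != 0)%:R) x w <= m%:R :> R) ->
  avg n (fun w => `|T (walk x w)| ^+ 2) <=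
  c * m%:R `^ s * avg n (cost (fun v => `|v| ^+ 2) x).
Proof.
move=> Tsc m0 sparse; set K := c * _.
have gainE k z : gain T (fun y => `|y| ^+ 2) (fun v => K * `|v| ^+ 2) k z 0 =
    avg k (fun w => `|T (walk z w)| ^+ 2)
    - K * avg k (cost (fun v => `|v| ^+ 2) z).
  rewrite /gain -mulNr -avgZ -avgD; apply: eq_avg => w _.
  by rewrite add0r costZ mulNr.
have [|x'] := compress_sparse T (fun y => `|y| ^+ 2) (fun v => K * `|v| ^+ 2)
  _ _ _ 0 _ sparse; first by rewrite normr0 expr0n mulr0.
rewrite !gainE => xx'; rewrite -subr_le0 (le_trans xx')//.
by rewrite subr_le0 Tsc.
Qed.

(** * Walks of bounded cost *)

Lemma powR2_lt1 {R : realType} (a : R) : a < 0 -> 0 < (2 : R) `^ a < 1.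
Proof.
move=> a0; rewrite powR_gt0//= lt_neqAle; apply/andP; split; last first.
  by rewrite -[leRHS](powRr0 (2 : R)) ler_powR ?ler1n// ltW.
rewrite powR_eq1 !negb_or (lt_eqF a0) andbT -leNgt ler0n andbT.
by rewrite gt_eqF ?ltr1n.
Qed.

(** Cauchy-Schwarz with the weights [rho ^+ i], whose sum is at most (1 - rho)^-1. *)
Lemma sqr_sum_geometric {R : realType} (rho : R) N (a : nat -> R) :
  0 < rho < 1 ->
  (\sum_(i < N) a i) ^+ 2 <= (1 - rho)^-1 * \sum_(i < N) rho^-1 ^+ i * a i ^+ 2.
Proof.
move=> /andP[rho0 rho1]; have rho1' : 0 < 1 - rho by rewrite subr_gt0.
elim: N a => [|N IHN] a; first by rewrite !big_ord0 expr0n mulr0.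
rewrite !big_ord_recl /bump /=; set b := (X in (_ + X) ^+ 2).
have -> : \sum_(i < N) rho^-1 ^+ (1 + i) * a (1 + i)%N ^+ 2 =
    rho^-1 * \sum_(i < N) rho^-1 ^+ i * a (1 + i)%N ^+ 2.
  by rewrite mulr_sumr; apply: eq_bigr => i _; rewrite add1n exprS mulrA.
have := IHN (fun i => a (1 + i)%N); rewrite -/b => IHb.
(* The difference of the two sides of (a + b)^2 <= a^2/(1 - rho) + b^2/rho is a square up to a
   positive factor. *)
apply: (@le_trans _ _ ((1 - rho)^-1 * a 0%N ^+ 2 + rho^-1 * b ^+ 2)).
  rewrite -subr_ge0.
  have -> : (1 - rho)^-1 * a 0%N ^+ 2 + rho^-1 * b ^+ 2 - (a 0%N + b) ^+ 2 =
      (rho * (1 - rho))^-1 * (rho * a 0%N - (1 - rho) * b) ^+ 2.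
    by field; rewrite !gt_eqF.
  by rewrite mulr_ge0 ?sqr_ge0// invr_ge0 mulr_ge0 ?ltW.
rewrite expr0 mul1r mulrDr lerD2l [leRHS]mulrCA.
by rewrite ler_pM2l ?invr_gt0.
Qed.

Lemma sum_successive_differences {V : zmodType} (f : nat -> V) N :
  \sum_(i < N) (f i - f i.+1) = f 0%N - f N.
Proof.
elim: N => [|N IHN]; first by rewrite big_ord0 subrr.
by rewrite big_ord_recr/= IHN addrA subrK.
Qed.

Section Uniform.
Context {R : realType} {X Y : normedModType R} (T : {linear X -> Y}).
Context (s c q : R).
Hypotheses (c0 : 0 <= c) (q0 : 0 < q) (q2 : q <= 2) (sq : s < 2 / q - 1).
Hypothesis Tsc : walk_bound T s c.

Let phi (v : X) : R := `|v| `^ q.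

Let phi0 : phi 0 = 0.
Proof. by rewrite /phi normr0 powR0// gt_eqF. Qed.

Let phi_ge0 v : 0 <= phi v.
Proof. exact: powR_ge0. Qed.

Let phi_gt0 v : v != 0 -> 0 < phi v.
Proof. by move=> v0; rewrite powR_gt0// normr_gt0. Qed.

(** Ratio of consecutive levels: doubling the number of steps costs 2^s, halving |v|^q gains
    2^(2/q-1) in |v|^2 relative to |v|^q. *)
Let rho : R := 2 `^ (s - (2 / q - 1)).

Let rho01 : 0 < rho < 1.
Proof. by apply: powR2_lt1; rewrite subr_lt0. Qed.

Let cut (x : seq bool -> X) i u : X := if phi (x u) <= 2^-1 ^+ i then x u else 0.
Let level x i u : X := cut x i u - cut x i.+1 u.

Let half_exp i : 2^-1 ^+ i.+1 <= 2^-1 ^+ i :> R.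
Proof. by rewrite exprS ler_piMl ?exprn_ge0 ?invr_ge0// invf_le1 ?ler1n. Qed.

Let levelP x i u : level x i u = 0 \/
  level x i u = x u /\ 2^-1 ^+ i.+1 < phi (x u) <= 2^-1 ^+ i.
Proof.
rewrite /level /cut; have [xi|xi] := leP (phi (x u)) (2^-1 ^+ i.+1).
  by rewrite (le_trans xi) ?half_exp// subrr; left.
have [xi'|xi'] := leP (phi (x u)) (2^-1 ^+ i); last by left; rewrite subrr.
by right; rewrite subr0.
Qed.

(** [phi] is not additive, but the finer cut either agrees with the coarser one or vanishes. Hence
    costs of levels telescope too. *)
Let phi_level x i u : phi (level x i u) = phi (cut x i u) - phi (cut x i.+1 u).
Proof.
rewrite /level /cut; have [xi|xi] := leP (phi (x u)) (2^-1 ^+ i.+1).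
  by rewrite (le_trans xi) ?half_exp// !subrr phi0.
by rewrite phi0 !subr0.
Qed.

(** On level [i], |v|^2 = phi(v)^(2/q-1) phi(v) with phi(v) <= 2^-i; q <= 2 makes the exponent
    nonnegative. *)
Let sqr_level x i u :
  `|level x i u| ^+ 2 <= (2^-1 ^+ i) `^ (2 / q - 1) * phi (level x i u).
Proof.
have [->|[-> /andP[lo hi]]] := levelP x i u.
  by rewrite phi0 normr0 expr0n mulr0.
have xu0 : 0 < phi (x u) by apply: le_lt_trans lo; rewrite exprn_ge0 ?invr_ge0.
have -> : `|x u| ^+ 2 = `|x u| `^ (q * (2 / q - 1 + 1)).
  by rewrite subrK mulrC divfK ?gt_eqF// powR_mulrn.
rewrite powRrM -/(phi (x u)) powRD; last by rewrite (gt_eqF xu0) implybT.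
rewrite powRr1 ?(ltW xu0)// ler_wpM2r ?(ltW xu0)//.
apply: ge0_ler_powR; rewrite ?nnegrE ?exprn_ge0 ?invr_ge0// ?(ltW xu0)//.
by rewrite subr_ge0 ler_pdivlMr// mul1r.
Qed.

Lemma walk_bound_uniform n x :
  (forall u, phi (x u) <= 1) -> (forall w, cost phi x w <= 1) ->
  avg n (fun w => `|T (walk x w)| ^+ 2) <=
  (1 - rho)^-1 * (c * 2 `^ s) * avg n (cost phi x).
Proof.
move=> x1 cost1.
have [N Ng] := positive_values_bounds n (phi \o x).
(* No nonzero node of a path of length [n] has [phi] below 2^-N, so the first [N] levels telescope
   to [x]. *)
have xE u : (size u < n)%N -> x u = \sum_(i < N) level x i u.
  move=> un; rewrite (sum_successive_differences (fun i => cut x i u)) /cut expr0 x1.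
  have [xN|] := leP (phi (x u)) (2^-1 ^+ N); last by rewrite subr0.
  have [->|xu0] := eqVneq (x u) 0; first by rewrite subr0.
  have /andP[] := Ng u (ltnW un) (phi_gt0 _ xu0).
  by rewrite /= ltNge xN.
(* A nonzero step of level [i] costs more than 2^-(i+1) out of a total of at most 1, so a path has
   at most 2^(i+1) of them. *)
have level_bound i : avg n (fun w => `|T (walk (level x i) w)| ^+ 2) <=
    c * 2 `^ s * rho ^+ i * avg n (cost phi (level x i)).
  apply: (le_trans (walk_bound_sparse _ _ _ n (2 ^ i.+1)%N _ Tsc _ _)).
  - by rewrite expn_gt0.
  - move=> w _; apply: (@le_trans _ _ (2 ^+ i.+1 * cost phi x w)); last first.
      by rewrite natrX ler_piMr ?exprn_ge0.
    rewrite -costZ; apply: ler_cost => u.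
    have [->|[-> /andP[lo _]]] := levelP x i u.
      by rewrite eqxx mulr_ge0 ?exprn_ge0.
    rewrite (@le_trans _ _ 1) ?lern1 ?leq_b1//.
    by rewrite -ler_pdivrMl ?exprn_gt0// mulr1 -exprVn ltW.
  - rewrite -!mulrA ler_wpM2l// natrX.
    have -> : (2 ^+ i.+1) `^ s = 2 `^ s * (2 `^ s) ^+ i :> R.
      by rewrite -powR_mulrn// powRAC powR_mulrn ?powR_ge0// exprS.
    rewrite -mulrA ler_wpM2l ?powR_ge0//.
    have -> : rho ^+ i = (2 `^ s) ^+ i * (2^-1 ^+ i) `^ (2 / q - 1).
      rewrite -[(2^-1 ^+ i)]powR_mulrn ?invr_ge0// powRAC powR_mulrn ?powR_ge0//.
      rewrite -exprMn -powR_inv1// -powRrM mulN1r -powRD//.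
      by rewrite pnatr_eq0 implybT.
    rewrite -mulrA ler_wpM2l ?exprn_ge0 ?powR_ge0// -avgZ; apply: ler_avg => w _.
    by rewrite -costZ; apply: ler_cost => u; exact: sqr_level.
(* The inverse weights of Cauchy-Schwarz cancel the decay [rho ^+ i] of [level_bound], after which
   the costs of the levels telescope. *)
apply: (@le_trans _ _ ((1 - rho)^-1 * \sum_(i < N) rho^-1 ^+ i *
    avg n (fun w => `|T (walk (level x i) w)| ^+ 2))).
  under [in leRHS]eq_bigr do rewrite -avgZ.
  rewrite -(avg_sum _ _ (fun i w => rho^-1 ^+ i * `|T (walk (level x i) w)| ^+ 2)).
  rewrite -avgZ; apply: ler_avg => w wn.
  apply: (le_trans _ (sqr_sum_geometric _ _ (fun i => `|T (walk (level x i) w)|)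
    rho01)).
  rewrite ler_sqr ?nnegrE ?sumr_ge0// (eq_walk n _ _ w xE wn) walk_sum linear_sum.
  exact: ler_norm_sum.
have /andP[rho0 rho1] := rho01.
rewrite -[leRHS]mulrA ler_wpM2l ?invr_ge0 ?subr_ge0 ?(ltW rho1)//.
apply: (@le_trans _ _ (\sum_(i < N) c * 2 `^ s * avg n (cost phi (level x i)))).
  apply: ler_sum => i _; rewrite -ler_pdivlMl ?exprn_gt0 ?invr_gt0//.
  by rewrite exprVn invrK mulrA [rho ^+ i * _]mulrC; exact: level_bound.
rewrite -mulr_sumr ler_wpM2l ?mulr_ge0 ?powR_ge0//.
rewrite -(avg_sum _ _ (fun i => cost phi (level x i))).
apply: ler_avg => w _; rewrite cost_nth; under eq_bigr do rewrite cost_nth.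
rewrite exchange_big ler_sum// => k _; under eq_bigr do rewrite phi_level.
rewrite (sum_successive_differences (fun i => phi (cut x i (take k w)))).
by rewrite /cut expr0 x1 lerBlDr lerDl.
Qed.
End Uniform.

(** * Stopping and interpolation *)

Section Stopping.
Context {R : realType} {X : normedModType R} (phi : X -> R).
Hypotheses (phi_ge0 : forall v, 0 <= phi v) (phi0 : phi 0 = 0).

(** The test includes the cost of the current node, so no step overshoots [B]. It depends on [u]
    alone, so the stopped object is again a tree of steps. *)
Definition stop (B : R) (x : seq bool -> X) (u : seq bool) : X :=
  if cost phi x u + phi (x u) <= B then x u else 0.

Lemma child_stop B x b :
  child (stop B x) b = stop (B - phi (x [::])) (child x b).
Proof.
by apply/funext => u; rewrite /stop lerBrDl addrA.
Qed.

(** In a subtree the budget drops by the first step, possibly below 0. Then every node is erased,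
    whence the maximum. *)
Lemma cost_stop B x w : cost phi (stop B x) w <= Num.max 0 B.
Proof.
elim: w B x => [|b w IHw] B x /=; first by rewrite le_max lexx.
rewrite child_stop; have := IHw (B - phi (x [::])) (child x b).
rewrite /stop /= add0r; have := phi_ge0 (x [::]).
set a := phi (x [::]); set d := cost _ _ _ => a0.
have [aB|Ba] := leP a B.
  have B0 := le_trans a0 aB.
  by rewrite !max_r ?subr_ge0// lerBrDl.
by rewrite phi0 add0r => /le_trans; apply; rewrite max_l ?le_max ?lexx// subr_le0 ltW.
Qed.

Lemma walk_stop B x w : cost phi x w <= B -> walk (stop B x) w = walk x w.
Proof.
elim: w B x => [//|b w IHw] B x /= xB.
rewrite child_stop IHw; last by rewrite lerBrDl.
by rewrite /stop/= add0r (le_trans _ xB)// lerDl cost_ge0.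
Qed.

(** Subadditivity of min(1, a) in a >= 0. *)
Lemma min_cost (x : seq bool -> X) w :
  Num.min 1 (cost phi x w) <= cost (fun v => Num.min 1 (phi v)) x w.
Proof.
elim: w x => [|b w IHw] x /=; first by rewrite ge_min lexx orbT.
have := IHw (child x b); set d := cost _ _ _; set e := cost _ _ _ => de.
have a0 := phi_ge0 (x [::]).
have d0 : 0 <= d by exact: cost_ge0.
have e0 : 0 <= e by apply: cost_ge0 => v; rewrite le_min ler01 phi_ge0.
have [a1|a1] := leP 1 (phi (x [::])).
  by rewrite ge_min lerDl e0.
move: de; have [d1 e1|_ de] := leP 1 d.
  by rewrite ge_min; apply/orP; left; lra.
by rewrite ge_min; apply/orP; right; rewrite lerD2l.
Qed.

End Stopping.

Section Truncated.
Context {R : realType} {X Y : normedModType R} (T : {linear X -> Y}).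
Context (phi : X -> R) (C : R).
Hypotheses (phi_ge0 : forall v, 0 <= phi v) (phi0 : phi 0 = 0) (C0 : 0 <= C).

Definition uniform_walk_bound : Prop :=
  forall n x, (forall u, phi (x u) <= 1) -> (forall w, cost phi x w <= 1) ->
  avg n (fun w => `|T (walk x w)| ^+ 2) <= C * avg n (cost phi x).

(** The walk is stopped at budget 1. Paths of cost at most 1 are unchanged and fall under the
    uniform bound; on the others the left side is at most 1, which [min_cost] bounds by the
    truncated cost. The two cases give [C] and 1. *)
Lemma uniform_truncated n x : uniform_walk_bound ->
  avg n (fun w => Num.min 1 (`|T (walk x w)| ^+ 2)) <=
  (C + 1) * avg n (cost (fun v => Num.min 1 (phi v)) x).
Proof.
move=> unif; pose x1 := stop phi 1 x.
have x1_le u : phi (x1 u) <= Num.min 1 (phi (x u)).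
  rewrite /x1 /stop; case: ifP => [xu|_]; last first.
    by rewrite phi0 le_min ler01 phi_ge0.
  by rewrite le_min lexx andbT (le_trans _ xu)// lerDr cost_ge0.
apply: (@le_trans _ _ (avg n (fun w => `|T (walk x1 w)| ^+ 2 +
    cost (fun v => Num.min 1 (phi v)) x w))).
  apply: ler_avg => w _.
  have [xw|/ltW xw] := leP (cost phi x w) 1.
    rewrite walk_stop// ge_min lerDl cost_ge0 ?orbT// => v.
    by rewrite le_min ler01 phi_ge0.
  rewrite ge_min; apply/orP; left.
  apply: (@le_trans _ _ (Num.min 1 (cost phi x w))); first by rewrite min_l.
  by rewrite (le_trans (min_cost _ _ _ _))// lerDr sqr_ge0.
rewrite avgD mulrDl mul1r lerD2r (le_trans (unif _ _ _ _))//.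
- by move=> u; rewrite (le_trans (x1_le u))// ge_min lexx.
- by move=> w; rewrite (le_trans (cost_stop _ _ _ _ _ _))// max_r.
- by rewrite ler_wpM2l//; apply: ler_avg => w _; apply: ler_cost.
Qed.

End Truncated.

Section Scales.
Context {R : realType} (r q : R).
Hypotheses (r1 : 1 <= r) (rq : r < q).

Let B : R := 2 `^ (r - q).

Let B01 : 0 < B < 1.
Proof. by apply: powR2_lt1; rewrite subr_lt0. Qed.

Let D : R := (1 - B)^-1.

Let DE : 1 + B * D = D.
Proof. by rewrite /D; field; have [] := andP B01; lra. Qed.

(** Discrete form of integrating t^(r-1) min(1, (a/t)^q) over t > 0. Scales below [a] sum to at most
    2 a^r since 2^r >= 2; those above form a geometric series of ratio [B]. *)
Lemma sum_scales_le N (alpha a : R) : 0 < alpha -> 0 < a ->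
  \sum_(i < N) (alpha * 2 ^+ i) `^ r * Num.min 1 ((a / (alpha * 2 ^+ i)) `^ q) <=
  (D + 2) * a `^ r.
Proof.
move=> alpha0 a0; have /andP[B0 B1] := B01.
have r0 : 0 <= r := le_trans ler01 r1.
have D0 : 0 < D by rewrite invr_gt0 subr_gt0.
(* A sharper bound, stable under the doubling of [alpha] in the induction. Above [a] it is the full
   geometric tail; below [a], the term -alpha^r pays for the first scale, as alpha^r - (2 alpha)^r
   <= -alpha^r. *)
pose G alpha : R := if a <= alpha then D * (alpha `^ r * (a / alpha) `^ q)
  else (D + 2) * a `^ r - alpha `^ r.
suff : \sum_(i < N) (alpha * 2 ^+ i) `^ r * Num.min 1 ((a / (alpha * 2 ^+ i)) `^ q)
    <= G alpha.
  move=> /le_trans; apply; rewrite /G; have [a_alpha|_] := leP a alpha; last first.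
    by rewrite lerBlDr lerDl powR_ge0.
  apply: (@le_trans _ _ (D * a `^ r)); last by rewrite ler_wpM2r ?powR_ge0// lerDl.
  rewrite ler_wpM2l ?(ltW D0)//.
  have -> : a `^ r = alpha `^ r * (a / alpha) `^ r.
    by rewrite -powRM ?divr_ge0 ?ltW// mulrC divfK ?gt_eqF.
  rewrite ler_wpM2l ?powR_ge0//; apply: ger_powR; last exact: ltW.
  by rewrite divr_gt0// ler_pdivrMr// mul1r.
elim: N alpha alpha0 => [|N IHN] alpha alpha0.
  rewrite big_ord0 /G; have [_|/ltW ale] := leP a alpha.
    by rewrite !mulr_ge0 ?powR_ge0// ltW.
  rewrite subr_ge0 (@le_trans _ _ (a `^ r))//.
    by apply: ge0_ler_powR; rewrite ?nnegrE// ltW.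
  by rewrite ler_peMl ?powR_ge0//; lra.
rewrite big_ord_recl expr0 mulr1.
under eq_bigr do rewrite lift0 exprS mulrA.
have a20 : 0 < alpha * 2 by rewrite mulr_gt0.
apply: (le_trans (lerD (lexx _) (IHN _ a20))).
have two_r : 2 <= 2 `^ r :> R by rewrite le1r_powR ?ler1n.
have aa0 : 0 <= a / alpha by rewrite divr_ge0 ?ltW.
have a2E : (alpha * 2) `^ r = alpha `^ r * 2 `^ r by rewrite powRM// ltW.
have ar0 := powR_ge0 alpha r.
rewrite /G; have [a_alpha|alpha_a] := leP a alpha.
  rewrite (le_trans a_alpha) ?ler_peMr ?ler1n ?(ltW alpha0)//.
  rewrite min_r; last first.
    rewrite (_ : 1 = 1 `^ q); last by rewrite powR1.
    have q0 : 0 <= q by exact: le_trans (ltW rq).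
    by apply: ge0_ler_powR; rewrite ?nnegrE// ler_pdivrMr ?mul1r.
  have -> : (a / (alpha * 2)) `^ q = (a / alpha) `^ q * 2 `^ (- q).
    by rewrite invfM mulrA powRM ?invr_ge0// -(@powR_inv1 _ 2)// -powRrM mulN1r.
  rewrite a2E; set z := alpha `^ r * (a / alpha) `^ q.
  rewrite (_ : D * _ = B * D * z); first by rewrite -{1}[z]mul1r -mulrDl DE.
  by rewrite /B powRD ?pnatr_eq0 ?implybT// /z; ring.
have min1 : alpha `^ r * Num.min 1 ((a / alpha) `^ q) <= alpha `^ r.
  by rewrite ler_piMr// ge_min lexx.
have [a_2|_] := leP a (alpha * 2); last first.
  by rewrite a2E; nra.
(* The doubled scale reaches [a] here: D a^r bounds the tail, and 2 a^r covers the two copies of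
   alpha^r. *)
have mono : alpha `^ r <= a `^ r.
  by apply: ge0_ler_powR; rewrite ?nnegrE// ltW.
have : (alpha * 2) `^ r * (a / (alpha * 2)) `^ q <= a `^ r.
  have -> : a `^ r = (alpha * 2) `^ r * (a / (alpha * 2)) `^ r.
    by rewrite -powRM ?divr_ge0 ?ltW// mulrC divfK ?gt_eqF.
  rewrite ler_wpM2l ?powR_ge0//; apply: ger_powR; last exact: ltW.
  by rewrite divr_gt0// ler_pdivrMr// mul1r.
by move=> le_ar; nra.
Qed.

(** Some scale z satisfies z <= y < 2z. Its term alone is z^r, and y^r <= 2^r z^r. *)
Lemma powR_le_sum_scales N (alpha y : R) : 0 < alpha ->
  alpha <= y < alpha * 2 ^+ N ->
  y `^ r <= 2 `^ r *
    \sum_(i < N) (alpha * 2 ^+ i) `^ r * Num.min 1 ((y / (alpha * 2 ^+ i)) ^+ 2).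
Proof.
move=> alpha0; elim: N => [|N IHN] /andP[y_ge y_lt].
  by move: y_lt; rewrite expr0 mulr1 ltNge y_ge.
have y0 : 0 < y by exact: lt_le_trans y_ge.
rewrite big_ord_recr /=; set z := alpha * 2 ^+ N.
have z0 : 0 < z by rewrite mulr_gt0 ?exprn_gt0.
have [zy|yz] := leP z y; last first.
  rewrite (le_trans (IHN _)) ?y_ge// ler_wpM2l ?powR_ge0// lerDl.
  by rewrite mulr_ge0 ?powR_ge0// le_min ler01 sqr_ge0.
rewrite min_l; last by rewrite exprn_ege1// ler_pdivlMr// mul1r.
rewrite mulr1 mulrDr (@le_trans _ _ (2 `^ r * z `^ r))//.
  rewrite -powRM ?(ltW z0)//.
  apply: ge0_ler_powR; rewrite ?nnegrE ?(le_trans ler01 r1) ?mulr_ge0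
    ?(ltW alpha0) ?exprn_ge0 ?(ltW y0)//.
  by rewrite /z mulrCA -exprS ltW.
rewrite lerDr mulr_ge0 ?powR_ge0// sumr_ge0// => i _.
by rewrite mulr_ge0 ?powR_ge0// le_min ler01 sqr_ge0.
Qed.

End Scales.

Lemma walk_bound_strong {R : realType} {X Y : normedModType R}
    (T : {linear X -> Y}) (s c r q : R) :
  0 <= c -> walk_bound T s c -> 1 <= r -> r < q -> q <= 2 -> s < 2 / q - 1 ->
  exists2 C : R, 0 <= C & forall n x,
    avg n (fun w => `|T (walk x w)| `^ r) <=
    C * avg n (cost (fun v => `|v| `^ r) x).
Proof.
move=> c0 Tsc r1 rq q2 sq.
have r0 : 0 < r := lt_le_trans ltr01 r1.
have q0 : 0 < q := lt_trans r0 rq.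
pose phi (v : X) : R := `|v| `^ q.
have phi_ge0 v : 0 <= phi v by exact: powR_ge0.
have phi0 : phi 0 = 0 by rewrite /phi normr0 powR0// gt_eqF.
have [C C0 unif] : exists2 C : R, 0 <= C & uniform_walk_bound T phi C.
  exists ((1 - 2 `^ (s - (2 / q - 1)))^-1 * (c * 2 `^ s)); last first.
    by move=> n x; exact: walk_bound_uniform.
  have /powR2_lt1/andP[_ /ltW rho1] : s - (2 / q - 1) < 0 by rewrite subr_lt0.
  by rewrite mulr_ge0 ?invr_ge0 ?subr_ge0 ?mulr_ge0 ?powR_ge0.
pose D : R := (1 - 2 `^ (r - q))^-1 + 2.
have D0 : 0 <= D.
  have /powR2_lt1/andP[_ /ltW B1] : r - q < 0 by rewrite subr_lt0.
  by rewrite addr_ge0// invr_ge0 subr_ge0.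
exists (2 `^ r * ((C + 1) * D)).
  by rewrite !mulr_ge0 ?powR_ge0 ?D0// addr_ge0.
move=> n x.
have [N TN] := positive_values_bounds n (fun w => `|T (walk x w)|).
(* The scales run from 2^-N by doubling, so [N + N] of them cover every nonzero value of |T walk| on
   words of length [n]. *)
pose lambda i : R := 2^-1 ^+ N * 2 ^+ i.
have N0 : 0 < 2^-1 ^+ N :> R by rewrite exprn_gt0 ?invr_gt0.
have lambda0 i : 0 < lambda i by rewrite mulr_gt0 ?exprn_gt0.
pose g i w := lambda i `^ r * Num.min 1 ((`|T (walk x w)| / lambda i) ^+ 2).
apply: (@le_trans _ _ (2 `^ r * \sum_(i < N + N) avg n (g i))).
  rewrite -avg_sum -avgZ; apply: ler_avg => w wn.
  have [->|Tw0] := eqVneq `|T (walk x w)| 0.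
    rewrite powR0 ?gt_eqF// mulr_ge0 ?powR_ge0// sumr_ge0// => i _.
    by rewrite mulr_ge0 ?powR_ge0// le_min ler01 sqr_ge0.
  have /andP[lo hi] : 2^-1 ^+ N < `|T (walk x w)| < 2 ^+ N.
    by apply: TN; rewrite ?wn// lt_neqAle eq_sym Tw0 normr_ge0.
  apply: powR_le_sum_scales => //; rewrite (ltW lo)/= exprD mulrA -exprMn.
  by rewrite mulVf ?pnatr_eq0// expr1n mul1r.
pose h i (v : X) := lambda i `^ r * Num.min 1 ((`|v| / lambda i) `^ q).
(* The truncated bound for the walk divided by [lambda i], multiplied by the r-th power of
   [lambda i]. *)
have scaled i : avg n (g i) <= (C + 1) * avg n (cost (h i) x).
  under [X in _ <= _ * X]eq_avg do rewrite costZ.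
  rewrite /g !avgZ [leRHS]mulrCA ler_wpM2l ?powR_ge0//.
  have := uniform_truncated T phi C phi_ge0 phi0 C0 n
    (fun u => (lambda i)^-1 *: x u) unif.
  congr (_ <= _ * _); apply: eq_avg => w _.
    rewrite walkZ linearZ normrZ ger0_norm ?invr_ge0 1?ltW//.
    by rewrite [_^-1 * _]mulrC.
  rewrite !cost_nth; apply: eq_bigr => k _.
  by rewrite /phi normrZ ger0_norm ?invr_ge0 1?ltW// [_^-1 * _]mulrC.
rewrite -!mulrA ler_wpM2l ?powR_ge0//.
apply: (@le_trans _ _ (\sum_(i < N + N) (C + 1) * avg n (cost (h i) x))).
  by apply: ler_sum => i _; exact: scaled.
rewrite -mulr_sumr ler_wpM2l ?addr_ge0//.
rewrite -(avg_sum _ _ (fun i => cost (h i) x)) -avgZ.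
apply: ler_avg => w _; rewrite -cost_sum -costZ; apply: ler_cost => u.
have [->|xu0] := eqVneq (x u) 0.
  rewrite normr0 powR0 ?gt_eqF// mulr0 big1// => i _.
  by rewrite /h normr0 mul0r powR0 ?gt_eqF// min_r ?mulr0.
by apply: sum_scales_le; rewrite ?normr_gt0.
Qed.

(** * Haar sums as walks *)

(** Most significant letter first, so that appending a letter passes from a dyadic interval to one
    of its halves. *)
Definition bin_val (w : seq bool) : nat :=
  foldl (fun a (b : bool) => (a.*2 + b)%N) 0%N w.

Lemma bin_val_rcons w b : bin_val (rcons w b) = ((bin_val w).*2 + b)%N.
Proof. by rewrite /bin_val foldl_rcons. Qed.

Lemma bin_val_lt w : (bin_val w < 2 ^ size w)%N.
Proof.
elim/last_ind: w => [//|w b IHw].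
rewrite bin_val_rcons size_rcons expnS; case: b; lia.
Qed.

Fixpoint word (k i : nat) : seq bool :=
  if k is k'.+1 then rcons (word k' i./2) (odd i) else [::].

Lemma bin_valK w : word (size w) (bin_val w) = w.
Proof.
elim/last_ind: w => [//|w b IHw].
rewrite size_rcons bin_val_rcons /= oddD odd_double halfD odd_double/=.
by rewrite doubleK add0n oddb; case: b; rewrite /= ?addn0 IHw.
Qed.

Lemma sum_even_odd {V : zmodType} (F : nat -> V) m :
  \sum_(0 <= i < m.*2) F i = \sum_(0 <= i < m) (F i.*2 + F i.*2.+1).
Proof.
elim: m => [|m IHm]; first by rewrite !big_geq.
by rewrite doubleS !big_nat_recr//= IHm addrA.
Qed.

(** [avg] branches on the first letter, whereas dyadic intervals are refined by appending a last
    one. *)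
Lemma avg_rcons {R : realType} n (g : seq bool -> R) :
  avg n.+1 g = avg n (fun w => (g (rcons w false) + g (rcons w true)) / 2).
Proof.
elim: n g => [//|n IHn] g.
by rewrite -[LHS]/((avg n.+1 (child g false) + avg n.+1 (child g true)) / 2)
  (IHn (child g false)) (IHn (child g true)).
Qed.

Lemma avg_take {R : realType} n k (g : seq bool -> R) : (k <= n)%N ->
  avg n (fun w => g (take k w)) = avg k g.
Proof.
elim: k n g => [|k IHk] n g.
  by move=> _; under eq_avg do rewrite take0; rewrite avg_cst.
case: n => [//|n] kn /=; rewrite -(IHk n (child g false))//.
by rewrite -(IHk n (child g true)).
Qed.

Lemma avg_words {R : realType} k (g : seq bool -> R) :
  avg k g = (\sum_(0 <= i < 2 ^ k) g (word k i)) / 2 ^+ k.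
Proof.
elim: k g => [|k IHk] g; first by rewrite big_nat1 divr1.
rewrite avg_rcons IHk expnS mul2n sum_even_odd -mulr_suml exprS invfM mulrA.
congr (_ / _ / _); apply: eq_bigr => i _ /=.
by rewrite odd_double uphalf_double doubleK.
Qed.

Section Cells.
Context {R : realType}.
Implicit Types t : R.

Definition in_cell (w : seq bool) t : bool := in_dyadic (size w) (bin_val w).+1 t.

Lemma in_dyadicE k i t :
  in_dyadic k i t = ((i.-1)%:R <= t * 2 ^+ k < i%:R).
Proof. by rewrite /in_dyadic ler_pdivrMr ?ltr_pdivlMr ?exprn_gt0. Qed.

Lemma in_dyadic_uniq k a i t : (0 < i)%N ->
  in_dyadic k a.+1 t -> in_dyadic k i t = (i == a.+1).
Proof.
rewrite !in_dyadicE => i0 /andP[at_ ta]; apply/andP/eqP => [[it ti]|->//].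
have : (i.-1 < a.+1)%N by rewrite -(ltr_nat R); exact: le_lt_trans ta.
have : (a < i)%N by rewrite -(ltr_nat R); exact: le_lt_trans ti.
by lia.
Qed.

Lemma in_cell_rcons w b t : in_cell (rcons w b) t -> in_cell w t.
Proof.
rewrite /in_cell !in_dyadicE /= bin_val_rcons size_rcons exprS mulrCA.
set v := bin_val w; set z := t * _ => /andP[lo hi].
move: lo hi; rewrite -natr1 natrD -muln2 natrM => lo hi; rewrite -natr1.
by case: b lo hi => /= lo hi; apply/andP; split; lra.
Qed.

Lemma in_cell_cat w1 w2 t : in_cell (w1 ++ w2) t -> in_cell w1 t.
Proof.
elim/last_ind: w2 => [|w2 b IHw]; first by rewrite cats0.
by rewrite -rcons_cat => /in_cell_rcons.
Qed.

Lemma in_cell_unit w t : in_cell w t -> 0 <= t < 1.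
Proof.
by move=> /(in_cell_cat [::] w); rewrite /in_cell in_dyadicE expr0 mulr1.
Qed.

(** For j = bin_val w + 1, the halves 2j-1 and 2j of the support are the cells of [rcons w false]
    and [rcons w true]. *)
Lemma haar_in_cell w b j t : (0 < j)%N -> in_cell (rcons w b) t ->
  haar (size w).+1 j t =
  if j == (bin_val w).+1 then (-1) ^+ b * Num.sqrt (2 ^+ size w) else 0.
Proof.
move=> j0 wt; rewrite /haar (in_cell_unit _ _ wt).
move: wt; rewrite /in_cell size_rcons bin_val_rcons => wt.
rewrite !(in_dyadic_uniq _ _ _ _ _ wt); [|lia|lia].
have [->|jv] := eqVneq j (bin_val w).+1.
  by case: b {wt}; rewrite /= ?expr1 ?expr0 ?mulN1r ?mul1r; do !case: eqP => //; lia.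
by case: b {wt}; do !case: eqP => //; move: jv => /eqP; lia.
Qed.

Context {V : normedModType R}.

(** The height of the Haar functions of level [(size u).+1] is absorbed into the node, leaving only
    signs. *)
Definition haar_tree (x : nat -> nat -> V) (u : seq bool) : V :=
  Num.sqrt (2 ^+ size u) *: x (size u).+1 (bin_val u).+1.

Lemma haar_level_in_cell x w b t : in_cell (rcons w b) t ->
  haar_level (size w).+1 x t = (-1) ^+ b *: haar_tree x w.
Proof.
move=> wt; rewrite /haar_level /=.
rewrite (eq_big_nat _ _ (F2 := fun j => if j == (bin_val w).+1 then
    (-1) ^+ b *: (Num.sqrt (2 ^+ size w) *: x (size w).+1 j) else 0)).
  by rewrite -big_mkcond big_nat1_eq /= ltnS bin_val_lt.
move=> j /andP[j0 _]; rewrite (haar_in_cell _ _ _ _ j0 wt).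
by case: eqP => _; rewrite ?scale0r// scalerA.
Qed.

Lemma haar_level_take x w k t : (k < size w)%N -> in_cell w t ->
  haar_level k.+1 x t = (-1) ^+ nth false w k *: haar_tree x (take k w).
Proof.
move=> kw wt; have kE : size (take k w) = k by rewrite size_take kw.
rewrite -[in LHS]kE; apply: haar_level_in_cell.
by rewrite -take_nth//; apply: (in_cell_cat _ (drop k.+1 w)); rewrite cat_take_drop.
Qed.

Lemma haar_sum_in_cell x w t : in_cell w t ->
  haar_sum (size w) x t = walk (haar_tree x) w.
Proof.
move=> wt; rewrite /haar_sum big_add1 /= walk_nth.
by apply: eq_big_nat => k /andP[_ kw]; rewrite -(haar_level_take _ _ _ _ kw wt).
Qed.

End Cells.

(** * Integrals of dyadic step functions *)

Section StepIntegral.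
Context {R : realType} (n : nat) (h : R -> R) (g : seq bool -> R).
Hypothesis h_ge0 : forall t, 0 <= h t.
Hypothesis hg : forall w t, size w = n -> in_cell w t -> h t = g w.

Let cell (w : seq bool) : set R :=
  `[(bin_val w)%:R / 2 ^+ size w, (bin_val w).+1%:R / 2 ^+ size w[%classic.

Let cellE w t : cell w t <-> in_cell w t.
Proof. by rewrite /cell /= in_itv. Qed.

Let measurable_cell w : measurable (cell w).
Proof. exact: measurable_itv. Qed.

Let cell_split w : cell w = (cell (rcons w false) `|` cell (rcons w true))%classic.
Proof.
apply/seteqP; split=> t; last first.
  by case=> /cellE /in_cell_rcons /cellE.
move=> /cellE; rewrite /in_cell in_dyadicE => /andP[lo hi].
have [tm|tm] := ltP (t * 2 ^+ size (rcons w false)) (bin_val (rcons w true))%:R.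
  left; apply/cellE; move: tm; rewrite /in_cell in_dyadicE !bin_val_rcons.
  rewrite !size_rcons exprS addn0 addn1 => ->; rewrite andbT.
  by rewrite -muln2 natrM mulrC mulrCA ler_pM2l.
right; apply/cellE; move: tm; rewrite /in_cell in_dyadicE !bin_val_rcons.
rewrite !size_rcons exprS => -> /=.
have -> : ((bin_val w).*2 + true).+1 = (bin_val w).+1.*2 by lia.
by move: hi; rewrite -muln2 natrM; lra.
Qed.

Let cell_disjoint w : [disjoint cell (rcons w false) & cell (rcons w true)]%classic.
Proof.
apply/disj_setPS => t [/cellE + /cellE].
rewrite /in_cell !size_rcons !bin_val_rcons => /in_dyadic_uniq -> //.
by rewrite eqSS eqn_add2l.
Qed.

(** Induction on the number [m] of letters still to be read, starting from full words, where [h] is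
    constant. Measurability is carried along for additivity over the two halves. *)
Let integral_cell m u : (size u + m)%N = n ->
  measurable_fun (cell u) (EFin \o h) /\
  (\int[lebesgue_measure]_(t in cell u) (h t)%:E)%E =
  (avg m (fun w => g (u ++ w)) / 2 ^+ size u)%:E.
Proof.
elim: m u => [|m IHm] u um.
  have hu : {in cell u, cst (g u)%:E =1 EFin \o h}.
    by move=> t /set_mem/cellE ut /=; rewrite (hg _ _ _ ut)// -um addn0.
  split; first by apply: (eq_measurable_fun (cst (g u)%:E)) => //; exact: hu.
  transitivity (\int[lebesgue_measure]_(t in cell u) cst (g u)%:E t)%E.
    by apply: eq_integral => t /hu.
  have mu_cell : lebesgue_measure (cell u) = ((2 ^+ size u)^-1)%:E.
    rewrite /cell lebesgue_measure_itv /= lte_fin ltr_pM2r ?invr_gt0 ?exprn_gt0//.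
    by rewrite ltr_nat ltnSn -EFinB -mulrBl -natr1 addrC addKr mul1r.
  rewrite integral_cst; last exact: measurable_cell.
  by rewrite [X in (_ * X)%E]mu_cell -EFinM /= cats0.
have [mf intf] := IHm (rcons u false) ltac:(by rewrite size_rcons addSnnS).
have [mt intt] := IHm (rcons u true) ltac:(by rewrite size_rcons addSnnS).
have mU : measurable_fun (cell (rcons u false) `|` cell (rcons u true))%classic
    (EFin \o h).
  by apply/measurable_funU.
rewrite cell_split; split=> //.
rewrite ge0_integral_setU//; [|exact: measurable_cell|exact: measurable_cell|].
  2: by move=> t _; rewrite lee_fin.
rewrite intf intt -EFinD !size_rcons -mulrDl exprS invfM mulrA.
congr (_ / _ / _)%:E; congr (_ + _); apply: eq_avg => w _;
  by rewrite /child cat_rcons.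
Qed.

Lemma integral_step :
  (\int[lebesgue_measure]_(t in `[0%R, 1%R[) (h t)%:E)%E = (avg n g)%:E.
Proof.
have [_] := integral_cell n [::] erefl.
by rewrite /cell /= !expr0 !divr1.
Qed.

End StepIntegral.

Lemma Lq_norm_step {R : realType} {V : normedModType R} n (q : R) (f : R -> V)
    (F : seq bool -> V) :
  (forall w t, size w = n -> in_cell w t -> `|f t| = `|F w|) ->
  Lq_norm q f = avg n (fun w => `|F w| `^ q) `^ q^-1.
Proof.
move=> fF; rewrite /Lq_norm (@integral_step _ n _ (fun w => `|F w| `^ q))//.
by move=> w t wn wt; rewrite (fF w).
Qed.

Section Transfer.
Context {R : realType} {V : normedModType R} (q : R).
Implicit Type x : nat -> nat -> V.

Lemma Lq_norm_haar_sum n x :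
  Lq_norm q (haar_sum n x) =
  avg n (fun w => `|walk (haar_tree x) w| `^ q) `^ q^-1.
Proof.
by apply: Lq_norm_step => w t <- wt; rewrite haar_sum_in_cell.
Qed.

Lemma sum_Lq_norm_haar_level n x : q != 0 ->
  \sum_(1 <= k < n.+1) Lq_norm q (haar_level k x) `^ q =
  avg n (cost (fun v => `|v| `^ q) (haar_tree x)).
Proof.
move=> q0; rewrite big_add1 /= big_mkord.
pose c k w := `|haar_tree x (take k w)| `^ q.
transitivity (\sum_(k < n) avg n (c k)); last first.
  rewrite -avg_sum; apply: eq_avg => w wn.
  by rewrite cost_nth wn big_mkord.
apply: eq_bigr => k _.
rewrite (@Lq_norm_step _ _ n _ _ (fun w => haar_tree x (take k w))).
  by rewrite -powRrM mulVf// powRr1// avg_ge0// => w _; exact: powR_ge0.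
move=> w t wn wt; rewrite (haar_level_take x w k t _ wt) ?wn//.
by rewrite normrZ normrX normrN1 expr1n mul1r.
Qed.

Definition tree_coeffs (z : seq bool -> V) (k j : nat) : V :=
  (Num.sqrt (2 ^+ k.-1))^-1 *: z (word k.-1 j.-1).

Lemma tree_coeffsK z : haar_tree (tree_coeffs z) = z.
Proof.
apply/funext => u; rewrite /haar_tree /tree_coeffs /= bin_valK scalerA.
by rewrite divff ?scale1r// sqrtr_eq0 -ltNge exprn_gt0.
Qed.

(** The squared normalisation is 2^-k at depth [k], which turns the sum over the 2^k nodes there
    into an average. *)
Lemma sum_sqr_tree_coeffs z n :
  \sum_(1 <= k < n.+1) \sum_(1 <= j < (2 ^ k.-1).+1) `|tree_coeffs z k j| ^+ 2 =
  avg n (cost (fun v => `|v| ^+ 2) z).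
Proof.
rewrite big_add1 /= big_mkord.
transitivity (\sum_(k < n) avg n (fun w => `|z (take k w)| ^+ 2)); last first.
  rewrite -(avg_sum _ _ (fun k w => `|z (take k w)| ^+ 2)).
  by apply: eq_avg => w wn; rewrite cost_nth wn big_mkord.
apply: eq_bigr => k _.
rewrite (avg_take n k (fun w => `|z w| ^+ 2)) 1?ltnW// avg_words.
rewrite big_add1 /= mulr_suml; apply: eq_bigr => j _.
rewrite /tree_coeffs /= normrZ exprMn normfV exprVn mulrC.
by rewrite ger0_norm ?sqrtr_ge0// sqr_sqrtr ?exprn_ge0.
Qed.

End Transfer.

Lemma haar_tree_linear {R : realType} {X Y : normedModType R}
    (T : {linear X -> Y}) (x : nat -> nat -> X) :
  haar_tree (fun k j => T (x k j)) = T \o haar_tree x.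
Proof. by apply/funext => u; rewrite /haar_tree /= linearZ. Qed.

(** Every tree [z] arises from the coefficients [tree_coeffs z], so the Haar inequality covers all
    walks. Squaring it gives [c ^+ 2] and the exponent 2/p - 1. *)
Lemma weak_haar_type_walk_bound {R : realType} {X Y : normedModType R}
    (T : {linear X -> Y}) (p : R) : weak_haar_type T p ->
  exists2 c : R, 0 <= c & walk_bound T ((p^-1 - 2^-1) * 2) c.
Proof.
move=> [c [c0 Tc]]; exists (c ^+ 2); first exact: sqr_ge0.
move=> n z n0; have [_ /(_ (tree_coeffs z))] := Tc n n0.
rewrite Lq_norm_haar_sum sum_sqr_tree_coeffs haar_tree_linear tree_coeffsK.
set A := avg n _; set S := avg n _ => AS.
have S0 : 0 <= S by apply: avg_ge0 => w _; apply: cost_ge0 => v; exact: sqr_ge0.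
have AE : A = avg n (fun w => `|T (walk z w)| ^+ 2).
  by apply: eq_avg => w _; rewrite powR_mulrn// walk_linear.
have A0 : 0 <= A by apply: avg_ge0 => w _; exact: powR_ge0.
rewrite -AE powRrM powR_mulrn ?powR_ge0// -exprMn -[S]sqr_sqrtr// -exprMn.
rewrite -[A]sqr_sqrtr// ler_sqr ?nnegrE ?sqrtr_ge0 ?mulr_ge0 ?powR_ge0//.
by rewrite -powR12_sqrt.
Qed.

Theorem theorem5p5 (R : realType) (X Y : completeNormedModType R)
  (T : {linear X -> Y})
  (hT : exists M : R, forall x : X, `|T x| <= M * `|x|)
  (p : R) (hp1 : 1 <= p) (hp2 : p < 2) :
  weak_haar_type T p ->
  forall r : R, 1 <= r -> r < p -> haar_type T r.
Proof.
move=> /weak_haar_type_walk_bound[c c0 Tc] r r1 rp.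
have r0 : 0 < r := lt_le_trans ltr01 r1.
pose q : R := (r + p) / 2.
have [rq qp] : r < q /\ q < p by rewrite /q; split; lra.
have q0 : 0 < q := lt_trans r0 rq.
(* This is 2/p - 1 < 2/q - 1, that is, q < p. *)
have sq : (p^-1 - 2^-1) * 2 < 2 / q - 1.
  rewrite mulrBl mulVf ?pnatr_eq0// ltrD2r mulrC ltr_pM2l//.
  by rewrite ltf_pV2 ?posrE// (lt_trans q0).
have [C C0 strong] := walk_bound_strong T _ c r q c0 Tc r1 rq
  (ltW (lt_trans qp hp2)) sq.
exists (C `^ r^-1) => n; split=> [|x]; first exact: powR_ge0.
rewrite Lq_norm_haar_sum sum_Lq_norm_haar_level ?gt_eqF// haar_tree_linear.
have cost0 : 0 <= avg n (cost (fun v => `|v| `^ r) (haar_tree x)).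
  by apply: avg_ge0 => w _; apply: cost_ge0 => v; exact: powR_ge0.
rewrite -powRM//; apply: ge0_ler_powR.
- by rewrite invr_ge0 ltW.
- by rewrite nnegrE avg_ge0// => w _; exact: powR_ge0.
- by rewrite nnegrE mulr_ge0.
- apply: le_trans (strong n (haar_tree x)).
  by apply: ler_avg => w _; rewrite walk_linear.
Qed.
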